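(* Let $G$ be a finitely presented group and let $H \leq G$ be a subgroup of finite index. Then $H$ is finitely presented.
   Context: A group is finitely presented if it admits a presentation with finitely many generators and finitely many relators. *)

(* Defs.v *)
From HB Require Import structures.
From mathcomp Require Import all_boot.
From mathcomp Require Import boolp classical_sets functions cardinality.

Set Implicit Arguments.
Unset Strict Implicit.
Unset Printing Implicit Defensive.

Local Open Scope group_scope.
Local Open Scope classical_set_scope.

(** The free group on [X]: reduced words over the letters [(x, b)], where
    [(x, false)] stands for [x] and [(x, true)] for its formal inverse. *)
Section FreeGroup.
Variable X : choiceType.
Implicit Types (a b : X * bool) (u v w : seq (X * bool)).

Definition inv_letter a := (a.1, ~~ a.2).

Definition reduced w := sorted [rel a b | b != inv_letter a] w.

Definition red_cons a w :=
  if w is b :: w' then if b == inv_letter a then w' else a :: w else [:: a].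

Definition red_cat u v := foldr red_cons v u.

Definition word_inv w := rev (map inv_letter w).

Lemma inv_letterK : involutive inv_letter.
Proof. by case=> x b; rewrite /inv_letter /= negbK. Qed.

Lemma reduced_cons a w : reduced (a :: w) -> reduced w.
Proof. exact: path_sorted. Qed.

Lemma red_cons_reduced a w : reduced w -> reduced (red_cons a w).
Proof.
case: w => [|b w] //= red_bw; case: ifPn => [_|nab].
  exact: reduced_cons red_bw.
by rewrite /reduced /= nab.
Qed.

Lemma red_consK a w : reduced w -> red_cons (inv_letter a) (red_cons a w) = w.
Proof.
case: w => [|b w] /=; first by rewrite inv_letterK eqxx.
case: ifPn => [/eqP-> | _ _]; last by rewrite /= inv_letterK eqxx.
case: w => [|c w] //=; rewrite /reduced /= => /andP[nc _].
by rewrite (negbTE nc).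
Qed.

Lemma red_cons_id a w : reduced (a :: w) -> red_cons a w = a :: w.
Proof. by case: w => [|b w] //=; rewrite /reduced /= => /andP[/negbTE->]. Qed.

Lemma red_cat_reduced u v : reduced v -> reduced (red_cat u v).
Proof. by move=> rv; elim: u => //= a u; apply: red_cons_reduced. Qed.

Lemma red_catr0 u : reduced u -> red_cat u [::] = u.
Proof.
elim: u => //= a u IHu rau.
by rewrite (IHu (reduced_cons rau)) red_cons_id.
Qed.

Lemma red_cat_cons a u v :
  reduced v -> red_cat (red_cons a u) v = red_cons a (red_cat u v).
Proof.
case: u => [|b u] //= rv; case: ifPn => [/eqP-> | //].
have := red_consK (inv_letter a) (red_cat_reduced u rv).
by rewrite inv_letterK.
Qed.

Lemma red_catA u v w :
  reduced w -> red_cat u (red_cat v w) = red_cat (red_cat u v) w.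
Proof. by move=> rw; elim: u => //= a u ->; rewrite red_cat_cons. Qed.

Lemma word_inv_reduced w : reduced w -> reduced (word_inv w).
Proof.
rewrite /word_inv /reduced rev_sorted sorted_map; apply: sub_sorted => a b.
by rewrite /= => nab; apply: contraNneq nab => ->; rewrite inv_letterK.
Qed.

Lemma red_cat_inv w v : reduced v -> red_cat (word_inv w) (red_cat w v) = v.
Proof.
move=> rv; elim: w => //= a w IHw.
rewrite /word_inv /= rev_cons /red_cat foldr_rcons red_consK //.
exact: red_cat_reduced.
Qed.

Lemma word_invK : involutive word_inv.
Proof.
by move=> w; rewrite /word_inv map_rev revK -map_comp map_id_in // => a _ /=;
  rewrite inv_letterK.
Qed.

Record free_group := FreeGroup {
  fg_word :> seq (X * bool);
  fg_reduced : reduced fg_word }.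

HB.instance Definition _ := [isSub for fg_word].
HB.instance Definition _ := [Choice of free_group by <:].

Implicit Types f g h : free_group.

Definition fg_one := @FreeGroup [::] isT.
Definition fg_mul f g := FreeGroup (red_cat_reduced f (fg_reduced g)).
Definition fg_inv f := FreeGroup (word_inv_reduced (fg_reduced f)).

Fact fg_mulA : associative fg_mul.
Proof. by move=> f g h; apply/val_inj/red_catA/fg_reduced. Qed.
Fact fg_mul1 : left_id fg_one fg_mul.
Proof. by move=> f; apply/val_inj. Qed.
Fact fg_mulr1 : right_id fg_one fg_mul.
Proof. by move=> f; apply/val_inj/red_catr0/fg_reduced. Qed.
Fact fg_mulV : left_inverse fg_one fg_inv fg_mul.
Proof.
move=> f; apply/val_inj => /=.
by rewrite -[X in red_cat _ X](red_catr0 (fg_reduced f)) red_cat_inv.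
Qed.
Fact fg_mulrV : right_inverse fg_one fg_inv fg_mul.
Proof.
move=> f; have fVK : fg_inv (fg_inv f) = f by apply/val_inj/word_invK.
by rewrite -{1}fVK fg_mulV.
Qed.

HB.instance Definition _ := isGroup.Build free_group
  fg_mulA fg_mul1 fg_mulr1 fg_mulV fg_mulrV.

End FreeGroup.

Inductive normal_closure (G : groupType) (R : {pred G}) : G -> Prop :=
| NormalClosureIn r of r \in R : normal_closure R r
| NormalClosure1 : normal_closure R 1
| NormalClosureM x y of normal_closure R x & normal_closure R y :
    normal_closure R (x * y)
| NormalClosureV x of normal_closure R x : normal_closure R x^-1
| NormalClosureJ x y of normal_closure R x : normal_closure R (x ^ y).

(** [G] is presented by < X | R > via [phi]: the homomorphism [phi] induces an
    isomorphism from the quotient of the free group by the normal closure of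
    [R] onto [G]. *)
Definition is_presentation (G : groupType) (X : choiceType)
    (R : {pred free_group X}) (phi : {multiplicative free_group X -> G}) :=
  (forall g : G, exists w, phi w = g) /\
  (forall w, phi w = 1 <-> normal_closure R w).

Definition finitely_presented (G : groupType) :=
  exists (X : finType) (R : seq (free_group X))
         (phi : {multiplicative free_group X -> G}), is_presentation (mem R) phi.

(** Subgroups are boolean predicates; by classical choice every subset of a
    type is of this form, and every type is a [choiceType]. *)
Definition subgroup (G : groupType) (H : groupClosed G) := {x : G | x \in H}.

Section Subgroup.
Variables (G : groupType) (H : groupClosed G).

HB.instance Definition _ := SubChoice.on (subgroup H).

Fact subgroup_closed : group_closed [pred x : G | x \in H].
Proof.
split=> [|x y]; rewrite ?inE ; first exact: gpred1.
exact: gpredF.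
Qed.

HB.instance Definition _ := SubChoice_isSubGroup.Build G _ (subgroup H) subgroup_closed.

End Subgroup.

(** The set of left cosets of [H] is finite. *)
Definition finite_index (G : groupType) (H : {pred G}) :=
  finite_set [set [set g * h | h in [set` H]] | g in [set: G]].

(* Main.v *)
(** Reidemeister rewriting with an arbitrary (not necessarily Schreier)
    transversal. Let [F -> G] be the given presentation, [F] acting on the finite
    set [I] of right cosets of [H], and [w i] a word representing the coset [i],
    the base coset being represented by [1]. On generators [(i, x)], the map
    [sigma (i, x) = w i * x / w (i x)] hits the preimage of [H] in [F], and the
    rewriting process [tau i u], determined by [tau i x = (i, x)] and
    [tau i (u v) = tau i u * tau (i u) v], satisfies
    [sigma (tau i u) = w i * u / w (i u)]. The relators [tau i r], for [r] a
    relator of [G], make [tau] send the kernel of [F -> G] into their normal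
    closure [N]; adding the finitely many relators [tau 1 (w i)] makes
    [tau 1 \o sigma] the identity modulo [N]. So if [y] dies in [H], then
    [sigma y] dies in [G], whence [tau 1 (sigma y)], and thus [y], lies in [N]. *)

Require Import Defs.
From mathcomp Require Import all_boot.
From HB Require Import structures.
From mathcomp Require Import classical_sets cardinality.

Set Implicit Arguments.
Unset Strict Implicit.
Unset Printing Implicit Defensive.

Local Open Scope group_scope.

Fact gmulf1_group (G K : groupType) (f : {multiplicative G -> K}) : f 1 = 1.
Proof. by apply: (mulgI (f 1)); rewrite -gmulfM !mulg1. Qed.

(** * Crossed homomorphisms on a free group *)

Section CrossedHom.
Variable X : choiceType.
Implicit Types (x : X) (a : X * bool) (u v : free_group X).

Definition fg_letter a : free_group X := @FreeGroup X [:: a] isT.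

Definition fg_gen x := fg_letter (x, false).

Lemma fg_letterM a u : fg_word (fg_letter a * u) = red_cons a u.
Proof. by []. Qed.

Lemma fg_letterV a : fg_letter (inv_letter a) = (fg_letter a)^-1.
Proof. exact/val_inj. Qed.

Lemma free_group_ind (P : free_group X -> Prop) :
  P 1 -> (forall a u, P u -> P (fg_letter a * u)) -> forall u, P u.
Proof.
move=> P1 PM [s]; elim: s => [|a s IHs] rs.
  by have -> : FreeGroup rs = 1 by apply/val_inj.
have -> : FreeGroup rs = fg_letter a * FreeGroup (reduced_cons rs).
  by apply/val_inj; rewrite /= red_cons_id.
exact/PM/IHs.
Qed.

Lemma free_group_genP (P : free_group X -> Prop) :
    P 1 -> (forall u v, P u -> P v -> P (u * v)) ->
    (forall u, P u -> P u^-1) -> (forall x, P (fg_gen x)) ->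
  forall u, P u.
Proof.
move=> P1 PM PV Pg; elim/free_group_ind => // -[x b] u Pu; apply: (PM) => //.
by case: b; [rewrite (fg_letterV (x, false)); apply/PV | ]; apply: Pg.
Qed.

Variables (G : groupType) (I : Type) (act : I -> free_group X -> I).
Hypothesis act1 : forall i, act i 1 = i.
Hypothesis actM : forall i u v, act i (u * v) = act (act i u) v.
Variable f : I -> X -> G.

(** The value at an inverse letter is forced by the crossed rule for [x^-1 * x = 1]. *)
Definition crossed_letter i a :=
  if a.2 then (f (act i (fg_letter a)) a.1)^-1 else f i a.1.

Fixpoint crossed_word i (s : seq (X * bool)) :=
  if s is a :: s' then crossed_letter i a * crossed_word (act i (fg_letter a)) s'
  else 1.

(** Fox-style extension of [f] to words by
    [d i (u * v) = d i u * d (act i u) v]; constant in [i] when [act] is trivial,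
    where it is the universal property of the free group. *)
Definition crossed i u := crossed_word i u.

Lemma act_letterK i a : act (act i (fg_letter a)) (fg_letter (inv_letter a)) = i.
Proof. by rewrite -actM fg_letterV mulgV act1. Qed.

Lemma crossed_letterK i a :
  crossed_letter i a * crossed_letter (act i (fg_letter a)) (inv_letter a) = 1.
Proof.
case: a => x [] /=; rewrite /crossed_letter /=; first by rewrite mulVg.
by rewrite (act_letterK i (x, false)) mulgV.
Qed.

Lemma crossed_letterM i a u :
  crossed i (fg_letter a * u)
  = crossed_letter i a * crossed (act i (fg_letter a)) u.
Proof.
rewrite /crossed fg_letterM; case: (fg_word u) => [|b s] //=.
(* If [a] cancels the first letter of [u], their values cancel too and the action returns to [i]. *)
by case: eqP => [-> | //]; rewrite mulgA crossed_letterK act_letterK mul1g.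
Qed.

Lemma crossedM i u v : crossed i (u * v) = crossed i u * crossed (act i u) v.
Proof.
elim/free_group_ind: u i => [|a u IHu] i; first by rewrite !mul1g act1.
by rewrite -mulgA !crossed_letterM IHu mulgA actM.
Qed.

Lemma crossedV i u : crossed (act i u) u^-1 = (crossed i u)^-1.
Proof. by apply/esym/mulg1_eq; rewrite -crossedM mulgV. Qed.

Lemma crossed_gen i x : crossed i (fg_gen x) = f i x.
Proof. by rewrite /crossed /= mulg1. Qed.

End CrossedHom.

(** * Universal property of the free group *)

Section Lift.
Variables (X : choiceType) (G : groupType) (f : X -> G).

Definition fg_lift : free_group X -> G :=
  crossed (fun _ _ => tt) (fun _ => f) tt.

Fact fg_liftM : {morph fg_lift : u v / u * v}.
Proof. by move=> u v; apply: crossedM => [[]|]. Qed.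

HB.instance Definition _ := isMultiplicative.Build _ _ fg_lift fg_liftM.
HB.instance Definition _ :=
  Multiplicative_isUMagmaMorphism.Build _ _ fg_lift (gmulf1_group fg_lift).

Lemma fg_lift_gen x : fg_lift (fg_gen x) = f x.
Proof. exact: crossed_gen. Qed.

End Lift.

(** * Right cosets of a subgroup of finite index *)

Lemma finite_index_cosets (G : groupType) (H : groupClosed G) :
  finite_index H ->
  exists (I : finType) (c : G -> I),
    (forall x y, c x = c y <-> x / y \in H) /\ (forall i, exists x, c x = i).
Proof.
move=> /finite_seqP[s sE].
(* Inversion matches the right coset of [g] with the left coset of [g^-1], and [finite_index] counts
   the latter. *)
pose C (g : G) : set G := [set g^-1 * h | h in [set` H]]%classic.
have Cs g : C g \in s.
  have : [set` s]%classic (C g) by rewrite -sE; exists g^-1.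
  by [].
exists (seq_sub s), (fun g => SeqSub (Cs g)); split=> [x y|[A As]]; last first.
  have : [set` s]%classic A by [].
  rewrite -sE => -[g _ gA]; exists g^-1; apply/val_inj => /=.
  by rewrite /C invgK.
split=> [[CE]|Hxy].
  have : C y (y^-1 * 1) by exists 1; rewrite //=; apply: gpred1.
  rewrite -CE mulg1 => -[h Hh hE].
  by rewrite -hE mulVKg.
apply/val_inj/seteqP; split=> _ [h Hh <-] /=.
  exists ((x / y)^-1 * h); first by apply: gpredM; rewrite // gpredV.
  by rewrite invgF !mulgA mulVg mul1g.
exists ((x / y) * h); first by apply: gpredM.
by rewrite !mulgA mulVg mul1g.
Qed.

Lemma gmulf_normal_closure (G K : groupType) (R : {pred G})
    (f : UMagmaMorphism.type G K) :
  (forall r, r \in R -> f r = 1) -> forall u, normal_closure R u -> f u = 1.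
Proof.
move=> fR u; elim=> {u} [||u v _ fu _ fv|u _ fu|u v _ fu]; first exact: fR.
- exact: gmulf1.
- by rewrite gmulfM fu fv mulg1.
- by rewrite gmulfV fu invg1.
- by rewrite gmulfJ fu conj1g.
Qed.

(** * Reidemeister rewriting and the presentation of the subgroup *)

Section Reidemeister.
Variables (G : groupType) (H : groupClosed G) (X I : finType).
Variables (R : seq (free_group X)) (phi : UMagmaMorphism.type (free_group X) G).
Hypothesis phi_pres : is_presentation (mem R) phi.
Variables (c : free_group X -> I) (w : I -> free_group X).
Hypothesis cP : forall u v, c u = c v <-> phi u / phi v \in H.
Hypothesis wK : cancel w c.
Hypothesis w_base : w (c 1) = 1.

Let act i u := c (w i * u).

Lemma act1 i : act i 1 = i. Proof. by rewrite /act mulg1 wK. Qed.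

Lemma cM u v t : c u = c v -> c (u * t) = c (v * t).
Proof. by rewrite !cP !gmulfM mulgKA. Qed.

Lemma actM i u v : act i (u * v) = act (act i u) v.
Proof. by rewrite /act mulgA; apply: cM; rewrite wK. Qed.

Lemma act_base u : act (c 1) u = c u.
Proof. by rewrite /act w_base mul1g. Qed.

Let Y := (I * X)%type.

Definition schreier (y : Y) := w y.1 * fg_gen y.2 / w (act y.1 (fg_gen y.2)).

Lemma phi_schreier y : phi (schreier y) \in H.
Proof. by rewrite gmulfF; apply/cP; rewrite wK. Qed.

Definition schreier_sub (y : Y) : subgroup H :=
  exist (fun g => g \in H) _ (phi_schreier y).

Local Notation sigma := (fg_lift schreier).
Local Notation psi := (fg_lift schreier_sub).

Definition rewriting := crossed act (fun i x => fg_gen ((i, x) : Y)).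

Local Notation tau := rewriting.

Lemma rewritingM i u v : tau i (u * v) = tau i u * tau (act i u) v.
Proof. exact: crossedM act1 actM _ _ _ _. Qed.

Lemma rewritingV i u : tau (act i u) u^-1 = (tau i u)^-1.
Proof. exact: crossedV act1 actM _ _ _. Qed.

Definition reidemeister_relators : seq (free_group Y) :=
  [seq tau i r | i <- enum I, r <- R] ++ [seq tau (c 1) (w i) | i <- enum I].

Local Notation N := (normal_closure (mem reidemeister_relators)).

Lemma val_psi y : val (psi y) = phi (sigma y).
Proof.
elim/free_group_genP: y => [|u v IHu IHv|u IHu|y].
- by rewrite !gmulf1.
- by rewrite !gmulfM /= IHu IHv.
- by rewrite !gmulfV /= IHu.
- by rewrite !fg_lift_gen.
Qed.

(** The product telescopes: the coset representatives between consecutive factors cancel. *)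
Lemma sigma_rewriting i u : sigma (tau i u) = w i * u / w (act i u).
Proof.
elim/free_group_genP: u i => [|u v IHu IHv|u IHu|x] i.
- by rewrite act1 mulg1 mulgV gmulf1.
- by rewrite rewritingM gmulfM /= IHu IHv actM !mulgA mulgVK.
- have {1}-> : i = act (act i u^-1) u by rewrite -actM mulVg act1.
  rewrite rewritingV gmulfV /= IHu -actM mulVg act1 invgF.
  by rewrite invgM mulgA.
- by rewrite /tau crossed_gen fg_lift_gen.
Qed.

Lemma act_normal_closure i u : normal_closure (mem R) u -> act i u = i.
Proof.
move=> /phi_pres.2 phi_u; rewrite -[RHS]wK; apply/cP.
by rewrite gmulfM phi_u mulg1 mulgV; apply: gpred1.
Qed.

Lemma rewriting_normal_closure i u : normal_closure (mem R) u -> N (tau i u).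
Proof.
move=> Ru; elim: Ru i => {u} [r Rr||u v Ru Nu _ Nv|u Ru Nu|u v Ru Nu] i.
- apply: NormalClosureIn; rewrite mem_cat; apply/orP; left.
  by apply/allpairsP; exists (i, r); rewrite /= mem_enum.
- exact: NormalClosure1.
- by rewrite rewritingM; apply: NormalClosureM.
- rewrite -{1}(act_normal_closure i Ru) rewritingV; exact: NormalClosureV.
(* Since [u] fixes [j], [tau i (u ^ v)] is the conjugate of [tau j u] by [tau j v]; hence the
   induction over all base points. *)
- set j := act i v^-1; have -> : i = act j v by rewrite -actM mulVg act1.
  rewrite conjgE rewritingM rewritingV -actM mulgV act1 rewritingM.
  by rewrite act_normal_closure // -conjgE; apply: NormalClosureJ.
Qed.

(** Makes [tau (c 1)] multiplicative on the image of [sigma], which stabilizes the base coset. *)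
Lemma act_sigma y : act (c 1) (sigma y) = c 1.
Proof.
rewrite act_base; apply/cP; rewrite gmulf1 divg1 -val_psi; exact: (valP (psi y)).
Qed.

Lemma rewriting_w i : N (tau (c 1) (w i)).
Proof.
apply: NormalClosureIn; rewrite mem_cat; apply/orP; right.
by apply: map_f; rewrite mem_enum.
Qed.

(* Modulo [N] the endomorphism [tau (c 1) \o sigma] fixes every generator, hence
   is the identity. *)
Lemma rewriting_sigma y : N (y^-1 * tau (c 1) (sigma y)).
Proof.
elim/free_group_genP: y => [|u v Nu Nv|u Nu|[i x]].
- by rewrite gmulf1 mulg1 invg1; exact: NormalClosure1.
- rewrite gmulfM /= rewritingM act_sigma invgM.
  set a := tau _ _ in Nu *; set b := tau _ _ in Nv *.
  have -> : v^-1 * u^-1 * (a * b) = (u^-1 * a) ^ v * (v^-1 * b).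
    by rewrite conjgE !mulgA mulgK.
  by apply: NormalClosureM => //; apply: NormalClosureJ.
- rewrite gmulfV /= -{1}(act_sigma u) rewritingV.
  set a := tau _ _ in Nu *.
  have -> : u^-1^-1 * a^-1 = ((u^-1 * a)^-1) ^ u^-1.
    by rewrite conjgE invgM !invgK !mulgA mulgK.
  by apply: NormalClosureJ; apply: NormalClosureV.
- have -> : sigma (fg_gen (i, x)) = w i * fg_gen x / w (act i (fg_gen x)).
    by rewrite fg_lift_gen.
  (* The word rewrites to the generator [(i, x)] between [tau (c 1) (w i)] and the inverse of
     [tau (c 1) (w j)], both in [N]. *)
  set j := act i _; rewrite !rewritingM !act_base wK -/(act i (fg_gen x)) -/j.
  have -> : tau i (fg_gen x) = fg_gen ((i, x) : Y) by rewrite /tau crossed_gen.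
  have {1}-> : j = act (c 1) (w j) by rewrite act_base wK.
  rewrite rewritingV mulgA -conjgE.
  apply: NormalClosureM; last by apply/NormalClosureV/rewriting_w.
  exact/NormalClosureJ/rewriting_w.
Qed.

Lemma psi_relator r : r \in reidemeister_relators -> psi r = 1.
Proof.
move=> Rr; apply/val_inj; rewrite val_psi gmulf1.
move: Rr; rewrite mem_cat => /orP[/allpairsP[[i s] [_ Rs ->]] | /mapP[i _ ->]].
  have Ns : normal_closure (mem R) s by apply: NormalClosureIn.
  rewrite sigma_rewriting /= act_normal_closure // gmulfF gmulfM.
  by rewrite (phi_pres.2 s).2 // mulg1 mulgV.
(* Here [sigma] already gives [w i / w i = 1] in the free group. *)
by rewrite sigma_rewriting act_base wK w_base mul1g mulgV gmulf1.
Qed.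

Lemma reidemeister_presentation :
  is_presentation (mem reidemeister_relators) psi.
Proof.
split=> [h|y]; last first.
  split=> [psi_y|]; last by apply: gmulf_normal_closure; apply: psi_relator.
  have Ns : N (tau (c 1) (sigma y)).
    apply/rewriting_normal_closure/phi_pres.2.
    by rewrite -val_psi psi_y gmulf1.
  set a := tau _ _ in Ns.
  have -> : y = a * (y^-1 * a)^-1 by rewrite invgM invgK mulVKg.
  by apply: NormalClosureM => //; apply/NormalClosureV/rewriting_sigma.
have [u phi_u] := phi_pres.1 (val h).
(* As [u] lies over an element of [H], it fixes the base coset, so [sigma (tau (c 1) u) = u]. *)
exists (tau (c 1) u); apply/val_inj; rewrite val_psi sigma_rewriting.
have -> : act (c 1) u = c 1.
  by rewrite act_base; apply/cP; rewrite phi_u gmulf1 divg1; exact: (valP h).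
by rewrite w_base mul1g divg1.
Qed.

End Reidemeister.

Theorem theorem3p1 (G : groupType) (H : groupClosed G) :
  finitely_presented G -> finite_index H -> finitely_presented (subgroup H).
Proof.
move=> [X [R [f f_pres]]] /finite_index_cosets[I [c [cP c_surj]]].
pose phi : UMagmaMorphism.type (free_group X) G := HB.pack (f : _ -> _)
  (isMultiplicative.Build _ _ f (@gmulfM _ _ f))
  (Multiplicative_isUMagmaMorphism.Build _ _ f (gmulf1_group f)).
have phi_pres : is_presentation (mem R) phi by [].
have c_ex i : exists u, c (phi u) == i.
  by have [x <-] := c_surj i; have [u <-] := phi_pres.1 x; exists u.
pose c' u := c (phi u).
(* The base coset is treated apart because [xchoose] might not pick [1] for it. *)
pose w i := if i == c' 1 then 1 else xchoose (c_ex i).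
have wK : cancel w c'.
  by move=> i; rewrite /w; case: eqP => [-> //|_]; apply/eqP/(xchooseP (c_ex i)).
have w_base : w (c' 1) = 1 by rewrite /w eqxx.
have c'P u v : c' u = c' v <-> phi u / phi v \in H by apply: cP.
by do 3!eexists; apply: (reidemeister_presentation phi_pres c'P wK w_base).
Qed.
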